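(* Let $(S,\cdot)$ be a semigroup and $A\subseteq S$. Then $A$ is an FP-set if and only if there is a pruned FP-tree in $A$. Moreover, if $\alpha\in A^*$ is idempotent, then there is an FP-tree $T$ in $A$ such that $\alpha\in B_f^*$ for all $f\in T$.
   Context: For a sequence $\langle s_n\rangle$ (finite or infinite) in $S$, $\mathrm{FP}(\langle s_n\rangle)$ is the set of all products $s_{j_1}s_{j_2}\cdots s_{j_k}$ with $j_1<\dots<j_k$, $k\ge1$. $A$ is an FP-set if there is a sequence $\langle s_n\rangle_{n=1}^\infty$ in $S$ with $\mathrm{FP}(\langle s_n\rangle_{n=1}^\infty)\subseteq A$. Trees: natural numbers $n$ are identified with $\{0,\dots,n-1\}$. A tree in a set $X$ is a nonempty set $T$ of functions $f:n\to X$ ($n\in\omega$) closed under restriction to initial segments. For $f\in T$ with domain $n$ and $x\in X$, $f^\frown x=f\cup\{(n,x)\}$; $B_f=\{x\in X:f^\frown x\in T\}$; $T$ is pruned if $B_f\ne\emptyset$ for all $f\in T$. For $f\subsetneq g$ in $T$ (with $X=S$), $P_{g-f}=\mathrm{FP}(\langle g(i)\rangle_{\mathrm{dom}(f)\le i<\mathrm{dom}(g)})$. A tree $T$ in $S$ is an FP-tree if $B_f=\bigcup_{g\in T,\,f\subsetneq g}P_{g-f}$ for every $f\in T$. ''A tree in $A$'' means a tree in the set $A$. Nonstandard setup: sufficiently saturated framework with iterated star map; $S^*$, $S^{**}$; for $\alpha\in S^*$, $\alpha^*\in S^{**}$, and $\alpha\cdot\alpha^*\in S^{**}$ by transfer.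 For $\gamma\in S^{(k)*}$, $\mathcal U_\gamma=\{B\subseteq S:\gamma\in B^{(k)*}\}$; $\gamma\sim\delta$ iff $\mathcal U_\gamma=\mathcal U_\delta$. $\alpha\in S^*$ is idempotent if $\alpha\cdot\alpha^*\sim\alpha$. *)

(* Defs.v *)
From HB Require Import structures.
From mathcomp Require Import all_boot.
From mathcomp Require Import boolp classical_sets functions cardinality.

Set Implicit Arguments.
Unset Strict Implicit.
Unset Printing Implicit Defensive.

Local Open Scope classical_set_scope.

(* ** FP-sets and trees *)

(* [s : nat -> option S] is a sequence indexed by the [i] with [s i <> None];
   [i :: js] runs over the nonempty increasing lists of such indices and
   [x :: xs] is the corresponding list of factors. *)
Definition FP (S : semigroupType) (s : nat -> option S) : set S :=
  [set p | exists (i : nat) (js : seq nat) (x : S) (xs : seq S),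
     [/\ sorted ltn (i :: js), map s (i :: js) = map Some (x :: xs)
       & p = foldl (fun a b => (a * b)%g) x xs]].

Definition FP_set (S : semigroupType) (A : set S) : Prop :=
  exists s : nat -> S, FP (fun n => Some (s n)) `<=` A.

(* A function [f : n -> X] with [n = {0, ..., n-1}] is the list
   [:: f 0; ...; f (n-1)] : its domain is [size f], its restrictions are the
   [take m f], and [f^x] is [rcons f x]. *)
Definition tree_in (X : Type) (A : set X) (T : set (seq X)) : Prop :=
  [/\ T !=set0,
      forall f, T f -> forall i x, onth f i = Some x -> A x
    & forall f m, T f -> T (take m f)].

Definition succs (X : Type) (T : set (seq X)) (f : seq X) : set X :=
  [set x | T (rcons f x)].

Definition pruned (X : Type) (T : set (seq X)) : Prop :=
  forall f, T f -> succs T f !=set0.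

Definition strict_ext (X : Type) (f g : seq X) : Prop :=
  (size f < size g)%N /\ take (size f) g = f.

Definition FP_diff (S : semigroupType) (f g : seq S) : set S :=
  FP (fun i => if (size f <= i)%N then onth g i else None).

Definition FP_tree (S : semigroupType) (T : set (seq S)) : Prop :=
  forall f, T f ->
    succs T f = \bigcup_(g in [set g | T g /\ strict_ext f g]) FP_diff f g.

(* ** Many-sorted first-order logic
   Every type is a sort, every element a constant symbol, every function a
   function symbol and every set a predicate symbol.  Product sorts give
   relations and operations of any arity; since [set X] is itself a sort,
   quantification over subsets is included too. *)

Record model := Model {
  star : Type -> Type;
  emb : forall X : Type, X -> star X;
  starfun : forall X Y : Type, (X -> Y) -> star X -> star Y;
  starset : forall X : Type, set X -> set (star X);
  starpair : forall X Y : Type, star X -> star Y -> star (X * Y)%type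
}.

Definition standard : model := {|
  star := fun X => X;
  emb := fun X x => x;
  starfun := fun X Y f => f;
  starset := fun X A => A;
  starpair := fun X Y x y => (x, y)
|}.

Fixpoint env (M : model) (G : seq Type) : Type :=
  if G is X :: G' then (star M X * env M G')%type else unit.

(* Typed de Bruijn variables: [G] lists the sorts of the free variables. *)
Inductive var : seq Type -> Type -> Type :=
| VZ (X : Type) (G : seq Type) : var (X :: G) X
| VS (X Y : Type) (G : seq Type) : var G X -> var (Y :: G) X.

Inductive term (G : seq Type) : Type -> Type :=
| Var (X : Type) : var G X -> term G X
| Cst (X : Type) : X -> term G X
| App (X Y : Type) : (X -> Y) -> term G X -> term G Y
| Pair (X Y : Type) : term G X -> term G Y -> term G (X * Y)%type.

Inductive formula : seq Type -> Type :=
| Pred (G : seq Type) (X : Type) : set X -> term G X -> formula G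
| Eq (G : seq Type) (X : Type) : term G X -> term G X -> formula G
| Not (G : seq Type) : formula G -> formula G
| And (G : seq Type) : formula G -> formula G -> formula G
| All (G : seq Type) (X : Type) : formula (X :: G) -> formula G.

Fixpoint lookup (M : model) (G : seq Type) (X : Type) (v : var G X) :
    env M G -> star M X :=
  match v in var G X return env M G -> star M X with
  | VZ _ _ => fun e => e.1
  | VS _ _ _ w => fun e => lookup w e.2
  end.

Fixpoint eval (M : model) (G : seq Type) (e : env M G) (X : Type)
    (t : term G X) : star M X :=
  match t in term _ X return star M X with
  | Var _ v => lookup v e
  | Cst _ x => emb M x
  | App _ _ f u => starfun f (eval e u)
  | Pair _ _ u v => starpair (eval e u) (eval e v)
  end.

Fixpoint holds (M : model) (G : seq Type) (p : formula G) : env M G -> Prop :=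
  match p in formula G return env M G -> Prop with
  | Pred _ _ A t => fun e => starset A (eval e t)
  | Eq _ _ t u => fun e => eval e t = eval e u
  | Not _ q => fun e => ~ holds q e
  | And _ q r => fun e => holds q e /\ holds r e
  | All _ X q => fun e => forall x : star M X, holds q (x, e)
  end.

(* ** Nonstandard frameworks
   [star] is defined on all types, so it can be iterated. *)

Record framework := Framework {
  fw_model :> model;
  transfer : forall p : formula [::],
    holds p (tt : env standard [::]) <-> holds p (tt : env fw_model [::])
}.

(* The internal subset of [X^*] given by an element of [P(X)^*], through the
   star of the membership relation. *)
Definition internal (N : framework) (X : Type) (b : star N (set X)) :
    set (star N X) :=
  [set x | starset [set p : X * set X | p.2 p.1] (starpair x b)].

(* [|I|^+]-saturation. *)
Definition saturated (N : framework) (I : Type) : Prop :=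
  forall (X : Type) (F : I -> star N (set X)),
    (forall J : set I, finite_set J ->
       \bigcap_(i in J) internal (F i) !=set0) ->
    \bigcap_(i in [set: I]) internal (F i) !=set0.

Fixpoint starn (N : framework) (k : nat) (X : Type) : Type :=
  if k is k'.+1 then star N (starn N k' X) else X.

Fixpoint starnset (N : framework) (k : nat) (X : Type) (B : set X) :
    set (starn N k X) :=
  match k return set (starn N k X) with
  | 0 => B
  | k'.+1 => starset (starnset (k := k') B)
  end.

Definition ult (N : framework) (X : Type) (k : nat) (c : starn N k X) :
    set (set X) :=
  [set B | starnset B c].

Definition equiv_gen (N : framework) (X : Type) (k l : nat)
    (c : starn N k X) (d : starn N l X) : Prop :=
  ult c = ult d.

Definition starop (N : framework) (X Y Z : Type) (f : X -> Y -> Z)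
    (x : star N X) (y : star N Y) : star N Z :=
  starfun (fun p : X * Y => f p.1 p.2) (starpair x y).

(* [a . a^*] : the second factor [a^*] is the star of the element [a], i.e.
   [emb N a]; the first factor is [a] seen in [S^**] through the inclusion
   of [S^*] in [S^**], which is the star of the inclusion [emb N] of [S] in
   [S^*]. *)
Definition mul_star (N : framework) (S : semigroupType) (a : star N S) :
    star N (star N S) :=
  starop (starop (fun x y : S => (x * y)%g))
    (starfun (@emb N S) a) (emb N a).

Definition star_idempotent (N : framework) (S : semigroupType) (a : star N S) :
    Prop :=
  @equiv_gen N S 2 1 (mul_star a) a.

(* Main.v *)
(* Both halves rest on trees described through the finite set of products of a
   list.  For an FP-set witnessed by [s], take the lists whose entries are
   products over successive blocks of [s].  For an idempotent [a] in [A^*], the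
   sets [B] with [a] in [B^*] form an idempotent ultrafilter; by Galvin's
   argument the set [C] of those [x] in [A] with [x^-1 A] in the ultrafilter
   belongs to it and satisfies [x^-1 C] in the ultrafilter for all [x] in [C],
   so one may take the lists all of whose products lie in [C].  Conversely, an
   infinite branch of a pruned FP-tree is a sequence with all products in [A]. *)
Require Import Defs.
From mathcomp Require Import all_boot.
From mathcomp Require Import boolp classical_sets functions cardinality.

Set Implicit Arguments.
Unset Strict Implicit.
Unset Printing Implicit Defensive.

Local Open Scope classical_set_scope.

(** * Products of finite lists *)

Section Products.
Variable S : semigroupType.
Implicit Types (l f g h : seq S) (x p q : S) (t : nat -> option S).

(** FP of a finite sequence by recursion on the list: a product is the head alone, omits the head,
    or begins with it. Index lists are thus replaced by list induction. *)
Fixpoint products l : set S :=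
  if l is x :: l' then
    [set p | [\/ p = x, products l' p
               | exists2 q, products l' q & p = (x * q)%g]]
  else set0.

Lemma products1 x : products [:: x] = [set x].
Proof.
apply/seteqP; split=> p /=; last by move=> ->; constructor 1.
by case=> // -[].
Qed.

Lemma products_catl l1 l2 : products l1 `<=` products (l1 ++ l2).
Proof.
elim: l1 => [|x l1 IH] p //= [-> | /IH ? | [q /IH ? ->]].
- by constructor 1.
- by constructor 2.
- by constructor 3; exists q.
Qed.

Lemma products_catr l1 l2 : products l2 `<=` products (l1 ++ l2).
Proof. by elim: l1 => [|x l1 IH] p //= /IH; constructor 2. Qed.

Lemma products_catM l1 l2 p q :
  products l1 p -> products l2 q -> products (l1 ++ l2) (p * q)%g.
Proof.
elim: l1 p => [|x l1 IH] p //= [-> | lp | [r lr ->]] lq.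
- by constructor 3; exists q => //; apply: products_catr.
- by constructor 2; apply: IH.
- by constructor 3; exists (r * q)%g; [apply: IH | rewrite mulgA].
Qed.

Lemma products_cat l1 l2 p : products (l1 ++ l2) p ->
  [\/ products l1 p, products l2 p
    | exists q r, [/\ products l1 q, products l2 r & p = (q * r)%g]].
Proof.
elim: l1 p => [|x l1 IH] p /=; first by constructor 2.
case=> [-> | /IH [?|?|[q [r [? ? ->]]]] | [z /IH [?|?|[q [r [? ? ->]]]] ->]].
- by constructor 1; constructor 1.
- by constructor 1; constructor 2.
- by constructor 2.
- by constructor 3; exists q, r; split=> //; constructor 2.
- by constructor 1; constructor 3; exists z.
- by constructor 3; exists x, z; split=> //; constructor 1.
- constructor 3; exists (x * q)%g, r; split=> //; last by rewrite mulgA.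
  by constructor 3; exists q.
Qed.

(** Merging a final segment into one of its products creates no new products. This yields the
    FP-tree property for trees defined by a condition on products. *)
Lemma products_rcons_sub f h p :
  products h p -> products (rcons f p) `<=` products (f ++ h).
Proof.
move=> hp q; rewrite -cats1 => /products_cat; rewrite products1.
case=> [? | /= -> | [r [_ [fr /= -> ->]]]].
- exact: products_catl.
- exact: products_catr.
- exact: products_catM.
Qed.

(** * FP of sequences through products of lists *)

Lemma foldl_mulg x y (xs : seq S) :
  foldl (fun a b => (a * b)%g) (x * y)%g xs
  = (x * foldl (fun a b => (a * b)%g) y xs)%g.
Proof. by elim: xs y => [|z xs IH] y //=; rewrite -mulgA IH. Qed.

Lemma products_pmap_sub_FP t n : products (pmap t (iota 0 n)) `<=` FP t.
Proof.
(* The bound [m <= i] is added so that an earlier index can be put in front while the index list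
   stays increasing. *)
suff FP_from m p : products (pmap t (iota m n)) p ->
    exists i js x xs, [/\ (m <= i)%N, sorted ltn (i :: js),
      map t (i :: js) = map Some (x :: xs)
      & p = foldl (fun a b => (a * b)%g) x xs].
  move=> p /FP_from[i [js [x [xs [_ ? ? ?]]]]].
  by exists i, js, x, xs.
elim: n m p => [|n IH] m p //=.
have step q : products (pmap t (iota m.+1 n)) q ->
    exists i js x xs, [/\ (m < i)%N, sorted ltn (i :: js),
      map t (i :: js) = map Some (x :: xs)
      & q = foldl (fun a b => (a * b)%g) x xs] by move=> /IH.
case tm: (t m) => [y|] /=; last first.
  by move=> /step[i [js [x [xs [/ltnW mi ? ? ?]]]]]; exists i, js, x, xs.
case=> [-> | /step[i [js [x [xs [/ltnW mi ? ? ?]]]]] | [q /step ih ->]].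
- by exists m, [::], y, [::]; split=> //=; rewrite tm.
- by exists i, js, x, xs.
- have [i [js [x [xs [mi /= srt [ti tjs] ->]]]]] := ih.
  exists m, (i :: js), y, (x :: xs); split=> //=; first by rewrite mi.
    by rewrite tm ti tjs.
  by rewrite foldl_mulg.
Qed.

Lemma FP_sub_products_pmap t :
  FP t `<=` \bigcup_n products (pmap t (iota 0 n)).
Proof.
suff from i js x xs : sorted ltn (i :: js) ->
    map t (i :: js) = map Some (x :: xs) ->
    exists n, products (pmap t (iota i n))
                (foldl (fun a b => (a * b)%g) x xs).
  move=> p [i [js [x [xs [srt tjs ->]]]]].
  have [n pn] := from _ _ _ _ srt tjs.
  exists (i + n)%N => //; rewrite iotaD pmap_cat.
  exact: products_catr.
elim: js i x xs => [|j js IH] i x xs /=.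
  move=> _ [ti /esym]; case: xs => // _.
  by exists 1%N; rewrite /= ti; constructor 1.
move=> /andP[ij srt] [ti]; case: xs => [//|y xs] [tj tjs].
have [|n pn] := IH j y xs srt; first by rewrite /= tj tjs.
(* The window starting at [i] consists of [i], the gap before [j], and the [n] indices from [j] on
   given by induction. *)
exists (1 + (j - i.+1 + n))%N => /=; rewrite ti /=; constructor 3.
exists (foldl (fun a b => (a * b)%g) y xs); last by rewrite foldl_mulg.
rewrite (iotaD _ (j - i.+1)) pmap_cat subnKC //.
exact: products_catr.
Qed.

Lemma pmap_onth_iota (X : Type) (l : seq X) m n :
  pmap (fun i => if (m <= i)%N then onth l i else None) (iota 0 n)
  = drop m (take n l).
Proof.
elim: n m l => [|n IH] m l; first by rewrite take0.
rewrite /= -[1%N]/(1 + 0)%N iotaDl.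
have pmapE m' (l' : seq X) (F : nat -> option X) :
    (forall i, F i.+1 = if (m' <= i)%N then onth l' i else None) ->
    pmap F (map (addn 1) (iota 0 n)) = drop m' (take n l').
  move=> FE; rewrite -IH; elim: (iota 0 n) => //= i s ->.
  by rewrite add1n FE.
case: l => [|x l]; last first.
  by case: m => [|m] /=; [rewrite (pmapE 0%N l) ?drop0 | rewrite (pmapE m l)].
rewrite (pmapE m [::]) => [|i]; last by rewrite !onth0n; do 2 case: ifP.
by case: m => [|m].
Qed.

Lemma FP_diffE f g : FP_diff f g = products (drop (size f) g).
Proof.
apply/seteqP; split=> p.
  move=> /FP_sub_products_pmap[n _]; rewrite pmap_onth_iota.
  rewrite -{2}(cat_take_drop n g) drop_cat size_take.
  case: ltnP => [_|gf] pn; first exact: products_catl.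
  (* Here [take n g] is no longer than [f], so [pn] would be a product of the empty list. *)
  by move: pn; rewrite drop_oversize // size_take.
move=> pg; apply: (@products_pmap_sub_FP _ (size g)).
by rewrite pmap_onth_iota take_size.
Qed.

Lemma FP_SomeE (s : nat -> S) :
  FP (fun n => Some (s n)) = \bigcup_n products (mkseq s n).
Proof.
have pmapE n : pmap (fun n => Some (s n)) (iota 0 n) = mkseq s n.
  by rewrite /mkseq; elim: (iota 0 n) => //= i js ->.
apply/seteqP; split=> p.
  by move=> /FP_sub_products_pmap[n _]; rewrite pmapE; exists n.
by move=> [n _]; rewrite -pmapE; apply: products_pmap_sub_FP.
Qed.

(** One inclusion is free: a successor [x] of [f] is the only product added by the extension
    [rcons f x]. The hypothesis gives the other one. *)
Lemma FP_treeI (T : set (seq S)) :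
  (forall f h x, T (f ++ h) -> products h x -> T (rcons f x)) -> FP_tree T.
Proof.
move=> Tprod f Tf; apply/seteqP; split=> x.
  move=> Tfx; exists (rcons f x).
    split=> //; split; first by rewrite size_rcons.
    by rewrite -cats1 take_size_cat.
  by rewrite FP_diffE -cats1 drop_size_cat // products1.
move=> [g [Tg [_ takeg]]]; rewrite FP_diffE => px.
by apply: Tprod px; rewrite -{1}takeg cat_take_drop.
Qed.

Lemma FP_tree_products (T : set (seq S)) h p :
  FP_tree T -> T [::] -> T h -> products h p -> T [:: p].
Proof.
move=> treeT T0 Th hp; suff : succs T [::] p by [].
rewrite treeT //; exists h; last by rewrite FP_diffE drop0.
by split=> //; split; [case: h hp {Th} | rewrite take0].
Qed.

(* [blocks l f]: the entries of [f] are products over successive disjoint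
   blocks of [l]; what remains of [l] after the last block is ignored. *)
Fixpoint blocks l f : Prop :=
  if f is x :: f' then
    exists l1 l2, [/\ l = l1 ++ l2, products l1 x & blocks l2 f']
  else True.

(** The first block absorbs [l1], since a product over a block may skip entries. *)
Lemma blocks_catr l1 l2 f : blocks l2 f -> blocks (l1 ++ l2) f.
Proof.
case: f => [|x f] //= [l3 [l4 [-> px bf]]].
exists (l1 ++ l3), l4; split=> //; first by rewrite catA.
exact: products_catr.
Qed.

Lemma blocks_cat l1 l2 f h :
  blocks l1 f -> blocks l2 h -> blocks (l1 ++ l2) (f ++ h).
Proof.
elim: f l1 => [|x f IH] l1 /=; first by move=> _; apply: blocks_catr.
move=> [l3 [l4 [-> px bf]]] bh; exists l3, (l4 ++ l2); rewrite catA.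
by split=> //; apply: IH.
Qed.

Lemma blocks_catP l f h : blocks l (f ++ h) ->
  exists l1 l2, [/\ l = l1 ++ l2, blocks l1 f & blocks l2 h].
Proof.
elim: f l => [|x f IH] l /=; first by exists [::], l.
move=> [l1 [l2 [-> px /IH[l3 [l4 [-> bf bh]]]]]].
by exists (l1 ++ l3), l4; rewrite catA; split=> //; exists l1, l3.
Qed.

Lemma blocks_products l f : blocks l f -> products f `<=` products l.
Proof.
elim: f l => [|x f IH] l /=; first by move=> _; apply: sub0set.
move=> [l1 [l2 [-> px /IH sub]]] p.
case=> [-> | /sub ? | [q /sub ? ->]].
- exact: products_catl.
- exact: products_catr.
- exact: products_catM.
Qed.

Lemma onth_products l i x : onth l i = Some x -> products l x.
Proof.
elim: l i => [|y l IH] [|i] //=.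
  by case=> ->; constructor 1.
by move=> /IH; constructor 2.
Qed.

(** * FP-sets and pruned FP-trees *)

Lemma FP_set_pruned_tree (A : set S) : FP_set A ->
  exists T : set (seq S), [/\ tree_in A T, FP_tree T & pruned T].
Proof.
move=> [s sA]; exists [set f | exists n, blocks (mkseq s n) f]; split.
- split; first by exists [::], 0%N.
    move=> f [n bf] i x /onth_products px; apply: sA; rewrite FP_SomeE.
    by exists n => //; apply: (blocks_products bf).
  move=> f m [n]; rewrite -{1}(cat_take_drop m f).
  move=> /blocks_catP[l1 [l2 [E bf _]]]; exists n; rewrite E.
  by rewrite -[take m f]cats0; apply: blocks_cat.
- apply: FP_treeI => f h x [n /blocks_catP[l1 [l2 [E bf bh]]]] px.
  exists n; rewrite E -cats1; apply: blocks_cat => //=.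
  (* The blocks under [h] merge into the single block [l2], over which [x] is a product. *)
  by exists l2, [::]; rewrite cats0; split=> //; apply: (blocks_products bh).
- move=> f [n bf]; exists (s n), n.+1; rewrite mkseqS -!cats1.
  apply: blocks_cat => //=.
  by exists [:: s n], [::]; split=> //; rewrite products1.
Qed.

Lemma pruned_tree_FP_set (A : set S) (T : set (seq S)) :
  tree_in A T -> FP_tree T -> pruned T -> FP_set A.
Proof.
move=> [[f0 Tf0] TA takeT] treeT prT.
have T0 : T [::] by rewrite -(take0 f0); apply: takeT.
have [x0 _] := prT _ T0.
have /choice[next nextP] : forall f, exists x, T f -> T (rcons f x).
  move=> f; have [/prT[x ?]|nTf] := pselect (T f); first by exists x.
  (* The default [x0] makes [next] total; only its values on [T] matter. *)
  by exists x0.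
pose branch := fix branch n :=
  if n is n'.+1 then rcons (branch n') (next (branch n')) else [::].
pose s n := next (branch n).
have branchE n : mkseq s n = branch n.
  by elim: n => [|n IH] //; rewrite mkseqS IH.
have Tbranch n : T (branch n) by elim: n => [|n IH] //=; apply: nextP.
exists s => p; rewrite FP_SomeE => -[n _]; rewrite branchE => pn.
(* By the FP property at the root, [p] is itself a node of length one, so its entry lies in [A]. *)
by apply: (TA [:: p] _ 0%N) => //; apply: FP_tree_products pn.
Qed.

End Products.

(** * Transfer and idempotents *)

Section Transfer.
Variable N : framework.

Lemma starset_holds (X : Type) (p : formula [:: X]) (a : star N X) :
  starset [set x : star standard X | holds (M := standard) p (x, tt)] a <->
  holds (M := N) p (a, tt).
Proof.
pose Q := [set x : X | holds (M := standard) p (x, tt)].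
pose q : formula [:: X] := Pred Q (Var (VZ X [::])).
(* The transferred sentence says that [p] and membership in [Q] agree everywhere, with the
   equivalence spelled out by [Not] and [And]. *)
have /(transfer N)/(_ a)[/= pq qp] : holds (M := standard)
    (All (And (Not (And p (Not q))) (Not (And q (Not p))))) tt.
  by move=> x /=; split=> -[? ?].
split=> ?; apply: contrapT => ?; [exact: qp | exact: pq].
Qed.

Lemma starset_setI (X : Type) (B C : set X) (a : star N X) :
  starset (B `&` C) a <-> starset B a /\ starset C a.
Proof.
pose v := Var (VZ X [::]).
exact: (starset_holds (And (Pred B v) (Pred C v))).
Qed.

Lemma starset_sub (X : Type) (B C : set X) (a : star N X) :
  B `<=` C -> starset B a -> starset C a.
Proof. by move=> /setIidl {1}<- /starset_setI[]. Qed.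

Lemma starset_setT (X : Type) (a : star N X) : starset [set: X] a.
Proof.
pose v := Var (VZ X [::]).
by apply: (@starset_sub _ [set x : X | x = x]) => //; apply/(starset_holds (Eq v v)).
Qed.

Lemma starset_starop_emb (X Y Z : Type) (f : X -> Y -> Z) (B : set Z) x
    (a : star N Y) :
  starset B (starop f (emb N x) a) <-> starset [set y | B (f x y)] a.
Proof.
symmetry; exact: (starset_holds (Pred B (App (fun p => f p.1 p.2)
  (Pair (Cst [:: Y] x) (Var (VZ Y [::])))))).
Qed.

(** Transfer with [a] as a constant of sort [star N S] and [emb N] as a function symbol. The right
    side is the product of the ultrafilter of [a] with itself. *)
Lemma starset_mul_star (S : semigroupType) (B : set S) (a : star N S) :
  starset (starset B) (mul_star a) <->
  starset [set x | starset [set y | B (x * y)%g] a] a.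
Proof.
have -> : [set x | starset [set y | B (x * y)%g] a] =
    [set x | starset B (starop (fun x y => x * y)%g (emb N x) a)].
  by apply/seteqP; split=> x /starset_starop_emb.
symmetry; exact: (starset_holds (Pred (starset B)
  (App (fun p => starop (fun x y : S => (x * y)%g) p.1 p.2)
    (Pair (App (@emb N S) (Var (VZ S [::]))) (Cst [:: S : Type] a))))).
Qed.

Lemma star_idempotentE (S : semigroupType) (B : set S) (a : star N S) :
  star_idempotent a ->
  starset B a <-> starset [set x | starset [set y | B (x * y)%g] a] a.
Proof.
move=> /(congr1 (fun U : set (set S) => U B)) idem.
by rewrite -starset_mul_star -[X in X <-> _]idem.
Qed.

(** A list has finitely many products, so this is closure under finite intersections. [Q] varies in
    the induction to allow the shift to [Q (y * p)]. *)
Lemma starset_products (S : semigroupType) (X : Type) (f : seq S)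
    (Q : S -> set X) (a : star N X) :
  (forall p, products f p -> starset (Q p) a) ->
  starset [set x | forall p, products f p -> Q p x] a.
Proof.
elim: f Q => [|y f IH] Q Qa.
  by apply: starset_sub (starset_setT a) => x _ p.
have Qy : starset (Q y) a by apply: Qa; constructor 1.
have Qf : starset [set x | forall p, products f p -> Q p x] a.
  by apply: IH => p fp; apply: Qa; constructor 2.
have Qyf : starset [set x | forall p, products f p -> Q (y * p)%g x] a.
  by apply: IH => p fp; apply: Qa; constructor 3; exists p.
have : starset (Q y `&` ([set x | forall p, products f p -> Q p x] `&`
    [set x | forall p, products f p -> Q (y * p)%g x])) a.
  by apply/starset_setI; split=> //; apply/starset_setI.
apply: starset_sub => x [Qyx [Qfx Qyfx]] p [-> | | [q fq ->]] //.
- exact: Qfx.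
- exact: Qyfx.
Qed.

Lemma idempotent_FP_tree (S : semigroupType) (A : set S) (a : star N S) :
  starset A a -> star_idempotent a ->
  exists T : set (seq S), [/\ tree_in A T, FP_tree T &
    forall f : seq S, T f -> starset (succs T f) a].
Proof.
move=> Aa idem.
pose C := A `&` [set x | starset [set y | A (x * y)%g] a].
have Ca : starset C a.
  by apply/starset_setI; split=> //; exact: (star_idempotentE A idem).1.
have Cmul p : C p -> starset [set x | C (p * x)%g] a.
  move=> [_ Ap].
  (* Idempotence is applied to the translate of [A] by [p], then associativity turns [p * (x * y)]
     into [(p * x) * y]. *)
  have := (star_idempotentE [set y | A (p * y)%g] idem).1 Ap.
  move=> /(conj Ap)/starset_setI; apply: starset_sub => x [Apx Apxa].
  split=> //; apply: starset_sub Apxa => y /=.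
  by rewrite mulgA.
exists [set f | products f `<=` C]; split.
- split; first by exists [::].
    by move=> f fC i x /onth_products/fC[].
  move=> f m fC p fp; apply: fC; rewrite -(cat_take_drop m f).
  exact: products_catl.
- apply: FP_treeI => f h x fhC hx.
  exact: subset_trans (products_rcons_sub hx) fhC.
- move=> f fC.
  have fCa : starset [set x | forall p, products f p -> C (p * x)%g] a.
    by apply: (starset_products (Q := fun p x => C (p * x)%g)) => p /fC/Cmul.
  (* A product of [rcons f x] is one of [f], or [x], or a product of [f] times [x]; [fC], [Cx] and
     [fCx] cover these cases. *)
  have /starset_setI := conj Ca fCa; apply: starset_sub => x [Cx fCx] p.
  rewrite -cats1 => /products_cat; rewrite products1.
  by case=> [/fC | -> | [q [_ [/fCx ? -> ->]]]].
Qed.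

End Transfer.

Theorem theorem4p1p3 (S : semigroupType) (A : set S) :
  (FP_set A <->
     exists T : set (seq S), [/\ tree_in A T, FP_tree T & pruned T]) /\
  (forall N : framework, saturated N (set S) ->
   forall a : star N S, starset A a -> star_idempotent a ->
     exists T : set (seq S),
       [/\ tree_in A T, FP_tree T &
           forall f : seq S, T f -> starset (succs T f) a]).
Proof.
split; last by move=> N _ a; apply: idempotent_FP_tree.
split; first exact: FP_set_pruned_tree.
by move=> [T [tA tT pT]]; apply: pruned_tree_FP_set tA tT pT.
Qed.
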